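(* Let $\delta\in\,]0,1]$, let $\widehat y\in\mathbb{R}^n$ satisfy $\|y-\widehat y\|\le\delta$, and let $(\widehat u_t)_{t\in\mathbb{N}}$ be the averaged sequence generated by the algorithm DGD with datum $\widehat y$. Assume that there exists $\bar v\in\mathbb{R}^n$ such that $-X^T\bar v\in\partial R(w^\dagger)$. Set $a=2\|X\|^{-1}$ and $b=\|X\|\,\|v^\dagger\|\,\alpha^{-1}$, where $v^\dagger$ is a solution of the dual problem $\min_{v\in\mathbb{R}^n} R^*(-X^Tv)+\langle y,v\rangle$. Then, for every $t\in\mathbb{N}$ with $t\ge 1$, $$\|\widehat u_t-w^\dagger\|\le a\,t^{1/2}\delta+b\,t^{-1/2}.$$ In particular, choosing $t_\delta=\lceil c\,\delta^{-1}\rceil$ for some $c>0$, $$\|\widehat u_{t_\delta}-w^\dagger\|\le\big[a(c^{1/2}+1)+b\,c^{-1/2}\big]\delta^{1/2}.$$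
   Context: $X\in\mathbb{R}^{n\times p}$ is a nonzero matrix, viewed as a linear map $\mathbb{R}^p\to\mathbb{R}^n$, and $\|X\|$ is its operator norm (Euclidean norms). $R:\mathbb{R}^p\to\,]-\infty,+\infty]$ is proper, lower semicontinuous and strongly convex, written as $R=F+\frac{\alpha}{2}\|\cdot\|^2$ with $\alpha\in\,]0,+\infty[$ and $F:\mathbb{R}^p\to\,]-\infty,+\infty]$ proper, lower semicontinuous and convex. $y\in\mathbb{R}^n$ is the exact datum and $w^\dagger\in\mathbb{R}^p$ is the (assumed existing, unique) solution of: minimize $R(w)$ subject to $Xw=y$; in particular $y=Xw^\dagger$. $R^*$ denotes the Fenchel conjugate of $R$, and $\partial R$ its convex subdifferential. Proximity operator: $\operatorname{prox}_{\alpha^{-1}F}(w)=\operatorname{argmin}_{u\in\mathbb{R}^p}\{F(u)+\frac{\alpha}{2}\|u-w\|^2\}$. Dual Gradient Descent (DGD) with datum $\widehat y$: let $\widehat v_0=0\in\mathbb{R}^n$ and $\gamma=\alpha\|X\|^{-2}$. For $t=0,1,2,\dots$: $$\widehat w_t=\operatorname{prox}_{\alpha^{-1}F}(-\alpha^{-1}X^T\widehat v_t),\qquad \widehat v_{t+1}=\widehat v_t+\gamma(X\widehat w_t-\widehat y),\qquad \widehat u_t=\frac{1}{t+1}\sum_{k=0}^t\widehat w_k .$$ *)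

(* Defs.v *)
From HB Require Import structures.
From mathcomp Require Import all_boot all_order all_algebra.
From mathcomp Require Import all_classical all_reals all_analysis.

Set Implicit Arguments.
Unset Strict Implicit.
Unset Printing Implicit Defensive.

Import Order.TTheory GRing.Theory Num.Theory.
Import numFieldNormedType.Exports.

Local Open Scope classical_set_scope.
Local Open Scope ring_scope.

(* The norm [`|x|] of the library on ['cV[R]_n] is the max norm, hence the
   explicit Euclidean structure below; the topology is the same. *)
Definition edot (R : realType) (n : nat) (x y : 'cV[R]_n) : R :=
  \sum_(i < n) x i 0 * y i 0.

Definition enorm (R : realType) (n : nat) (x : 'cV[R]_n) : R :=
  Num.sqrt (edot x x).

Definition opnorm (R : realType) (n p : nat) (X : 'M[R]_(n, p)) : R :=
  sup [set enorm (X *m w) | w in [set w : 'cV[R]_p | enorm w <= 1]].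

Section ConvexAnalysis.
Variables (R : realType) (p : nat).
Implicit Types (f : 'cV[R]_p -> \bar R) (w x y z : 'cV[R]_p).

Definition proper_fun f : Prop :=
  (forall x, f x != -oo%E) /\ (exists x, f x != +oo%E).

(* For functions that do not take the value -oo, the sums below are never of
   the form (+oo) + (-oo). *)
Definition econvex f : Prop :=
  forall x y (l : R), 0 < l < 1 ->
    (f (l *: x + (1 - l) *: y)%R <= l%:E * f x + (1 - l)%:E * f y)%E.

Definition strongly_econvex f : Prop :=
  exists2 mu : R, 0 < mu & forall x y (l : R), 0 < l < 1 ->
    (f (l *: x + (1 - l) *: y)%R
       + (mu / 2 * l * (1 - l) * enorm (x - y) ^+ 2)%:E
     <= l%:E * f x + (1 - l)%:E * f y)%E.

Definition argmin (A : set 'cV[R]_p) f : set 'cV[R]_p :=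
  [set x | A x /\ forall z, A z -> (f x <= f z)%E].

(* If [f] is proper, this set is empty at the points where [f] is +oo. *)
Definition subdifferential f w : set 'cV[R]_p :=
  [set u | forall z, (f w + (edot u (z - w))%:E <= f z)%E].

Definition fenchel_conjugate f (u : 'cV[R]_p) : \bar R :=
  ereal_sup [set ((edot u w)%:E - f w)%E | w in setT].

(* [prox alpha f] is the proximity operator of [alpha^-1 f]. *)
Definition prox (alpha : R) f w : 'cV[R]_p :=
  get (argmin setT (fun u => (f u + (alpha / 2 * enorm (u - w) ^+ 2)%:E)%E)).

End ConvexAnalysis.

Section DualGradientDescent.
Variables (R : realType) (n p : nat) (X : 'M[R]_(n, p)).
Variables (F : 'cV[R]_p -> \bar R) (alpha : R) (y : 'cV[R]_n).

Definition dgd_primal (v : 'cV[R]_n) : 'cV[R]_p :=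
  prox alpha F (- alpha^-1 *: (X^T *m v)).

Fixpoint dgd_v (t : nat) : 'cV[R]_n :=
  if t is s.+1 then
    dgd_v s + (alpha * opnorm X ^- 2) *: (X *m dgd_primal (dgd_v s) - y)
  else 0.

Definition dgd_w (t : nat) : 'cV[R]_p := dgd_primal (dgd_v t).

Definition dgd_u (t : nat) : 'cV[R]_p :=
  t.+1%:R^-1 *: \sum_(0 <= k < t.+1) dgd_w k.

End DualGradientDescent.

Definition dual_objective (R : realType) (n p : nat) (X : 'M[R]_(n, p))
    (J : 'cV[R]_p -> \bar R) (y v : 'cV[R]_n) : \bar R :=
  (fenchel_conjugate J (- (X^T *m v)) + (edot y v)%:E)%E.

(* Main.v *)
(* With q_k = - X^T v_k, the primal iterate w_k minimizes J - <q_k, .>, that is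
   q_k \in dJ(w_k), while - X^T vdag \in dJ(wdag) for every dual solution vdag.
   Strong monotonicity of dJ makes the exact dual step firmly nonexpansive
   around vdag: it lowers |v_k - vdag|^2 by gamma alpha |w_k - wdag|^2.  The
   noise moves each step by at most gamma delta, whence by induction
     gamma alpha sum_(j < k) |w_j - wdag|^2 + |v_k - vdag|^2
       <= (|vdag| + k gamma delta)^2,
   and Jensen's inequality turns the sum into a bound on the averaged iterate. *)
Require Import Defs.
From HB Require Import structures.
From mathcomp Require Import all_boot all_order all_algebra.
From mathcomp Require Import all_classical all_reals all_analysis.
From mathcomp Require Import ring lra.

Set Implicit Arguments.
Unset Strict Implicit.
Unset Printing Implicit Defensive.

Import Order.TTheory GRing.Theory Num.Theory.
Import numFieldNormedType.Exports.

Local Open Scope classical_set_scope.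
Local Open Scope ring_scope.

(** * Euclidean inner product and norm on column vectors *)

Section Euclidean.
Variables (R : realType) (n : nat).
Implicit Types (x y z : 'cV[R]_n) (a : R).

Lemma edotC x y : edot x y = edot y x.
Proof. by apply: eq_bigr => i _; rewrite mulrC. Qed.

Lemma edotDl x y z : edot (x + y) z = edot x z + edot y z.
Proof. by rewrite -big_split; apply: eq_bigr => i _; rewrite mxE mulrDl. Qed.

Lemma edotDr x y z : edot x (y + z) = edot x y + edot x z.
Proof. by rewrite edotC edotDl !(edotC x). Qed.

Lemma edotZl a x y : edot (a *: x) y = a * edot x y.
Proof. by rewrite mulr_sumr; apply: eq_bigr => i _; rewrite mxE mulrA. Qed.

Lemma edotZr a x y : edot x (a *: y) = a * edot x y.
Proof. by rewrite edotC edotZl edotC. Qed.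

Lemma edotNl x y : edot (- x) y = - edot x y.
Proof. by rewrite -scaleN1r edotZl mulN1r. Qed.

Lemma edotNr x y : edot x (- y) = - edot x y.
Proof. by rewrite edotC edotNl edotC. Qed.

Lemma edot0r x : edot x 0 = 0.
Proof. by rewrite /edot big1// => i _; rewrite mxE mulr0. Qed.

Definition edotE := (edotDl, edotDr, edotNl, edotNr, edotZl, edotZr).

Lemma edot_ge0 x : 0 <= edot x x.
Proof. by apply: sumr_ge0 => i _; rewrite -expr2 sqr_ge0. Qed.

Lemma enorm_ge0 x : 0 <= enorm x.
Proof. exact: sqrtr_ge0. Qed.

Lemma sqr_enorm x : enorm x ^+ 2 = edot x x.
Proof. by rewrite sqr_sqrtr ?edot_ge0. Qed.

Lemma enorm0 : enorm (0 : 'cV[R]_n) = 0.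
Proof. by rewrite /enorm edot0r sqrtr0. Qed.

Lemma enormZ a x : enorm (a *: x) = `|a| * enorm x.
Proof.
by rewrite /enorm edotZl edotZr mulrA -expr2 sqrtrM ?sqr_ge0// sqrtr_sqr.
Qed.

Lemma enormN x : enorm (- x) = enorm x.
Proof. by rewrite -scaleN1r enormZ normrN1 mul1r. Qed.

Lemma enorm_coord x i : `|x i 0| <= enorm x.
Proof.
rewrite -sqrtr_sqr ler_sqrt ?edot_ge0// /edot (bigD1 i)//= expr2 lerDl.
by apply: sumr_ge0 => j _; rewrite -expr2 sqr_ge0.
Qed.

Lemma enorm_eq0 x : enorm x = 0 -> x = 0.
Proof.
move=> x0; apply/matrixP => i j; rewrite (ord1 j) mxE; apply/eqP.
by rewrite -normr_le0 -x0 enorm_coord.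
Qed.

(** For nonzero vectors, expand the squared norm of [enorm y *: x - enorm x *: y], which is
    nonnegative, and cancel the factor [enorm x * enorm y]. *)
Lemma cauchy_schwarz x y : edot x y <= enorm x * enorm y.
Proof.
have [x0|x0] := eqVneq (enorm x) 0.
  by rewrite (enorm_eq0 x0) enorm0 edotC edot0r mul0r.
have [y0|y0] := eqVneq (enorm y) 0.
  by rewrite (enorm_eq0 y0) enorm0 edot0r mulr0.
have xy0 : 0 < enorm x * enorm y by rewrite mulr_gt0// lt0r enorm_ge0 andbT.
have := edot_ge0 (enorm y *: x - enorm x *: y).
rewrite !edotE (edotC y x) -!sqr_enorm => h.
rewrite -(ler_pM2l xy0); lra.
Qed.

Lemma enormD x y : enorm (x + y) <= enorm x + enorm y.
Proof.
rewrite -ler_sqr ?nnegrE ?addr_ge0 ?enorm_ge0//.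
rewrite sqr_enorm !edotE (edotC y x) -!sqr_enorm.
by have := cauchy_schwarz x y; lra.
Qed.

(* Summing [`|N x_k - S|^2 >= 0] over [k], where [S] is the sum. *)
Lemma sqr_enorm_sum (x : nat -> 'cV[R]_n) (N : nat) :
  enorm (\sum_(0 <= k < N) x k) ^+ 2
    <= N%:R * \sum_(0 <= k < N) enorm (x k) ^+ 2.
Proof.
set S := \sum_(_ <= _ < _) x _.
case: N @S => [|N] S; first by rewrite /S !big_nil enorm0 expr0n mulr0.
have N0 : 0 < N.+1%:R :> R by rewrite ltr0n.
have : 0 <= \sum_(0 <= k < N.+1) enorm (N.+1%:R *: x k - S) ^+ 2.
  by apply: sumr_ge0 => k _; rewrite sqr_ge0.
have -> : \sum_(0 <= k < N.+1) enorm (N.+1%:R *: x k - S) ^+ 2 =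
  \sum_(0 <= k < N.+1) (N.+1%:R ^+ 2 * enorm (x k) ^+ 2
    - 2 * N.+1%:R * edot S (x k) + enorm S ^+ 2).
  apply: eq_bigr => k _; rewrite !sqr_enorm !edotE (edotC (x k)); ring.
have SS : \sum_(0 <= k < N.+1) edot S (x k) = enorm S ^+ 2.
  rewrite sqr_enorm {3}/S; elim/big_rec2: _ => [|k a v _ ->]; first by rewrite edot0r.
  by rewrite edotDr.
rewrite big_split sumrB -!mulr_sumr SS sumr_const_nat subn0 -[_ *+ N.+1]mulr_natl /=.
set A := \sum_(_ <= _ < _) _ => h.
rewrite -(ler_pM2l N0); lra.
Qed.

End Euclidean.

(** * Adjoint and operator norm of a matrix *)

Lemma edot_trmx (R : realType) (n p : nat) (X : 'M[R]_(n, p)) v w :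
  edot (X^T *m v) w = edot v (X *m w).
Proof.
rewrite /edot; under eq_bigr do rewrite mxE mulr_suml.
rewrite exchange_big; apply: eq_bigr => j _.
rewrite mxE mulr_sumr; apply: eq_bigr => i _; rewrite mxE; ring.
Qed.

Section OperatorNorm.
Variables (R : realType) (n p : nat) (X : 'M[R]_(n, p)).

(** On the unit ball, [X *m w] combines the columns of [X] with coefficients of absolute value at
    most 1. Boundedness is what makes the [sup] in [opnorm] a genuine supremum. *)
Lemma opnorm_has_ubound :
  has_ubound [set enorm (X *m w) | w in [set w : 'cV[R]_p | enorm w <= 1]].
Proof.
exists (\sum_(j < p) enorm (col j X)) => _ [w /= w1 <-].
have -> : X *m w = \sum_(j < p) w j 0 *: col j X.
  apply/matrixP => i k; rewrite (ord1 k) mxE summxE.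
  by apply: eq_bigr => j _; rewrite !mxE mulrC.
elim/big_ind2: _ => [|u a v b ua vb|j _].
- by rewrite enorm0.
- by rewrite (le_trans (enormD _ _))// lerD.
- rewrite enormZ ler_piMl ?enorm_ge0//.
  exact: le_trans (enorm_coord _ _) w1.
Qed.

Lemma enorm_mulmx w : enorm (X *m w) <= opnorm X * enorm w.
Proof.
have [w0|w0] := eqVneq (enorm w) 0.
  by rewrite (enorm_eq0 w0) mulmx0 !enorm0 mulr0.
have wgt0 : 0 < enorm w by rewrite lt0r w0 enorm_ge0.
rewrite -ler_pdivrMr// -(ger0_norm (enorm_ge0 w)) mulrC -normfV -enormZ.
rewrite scalemxAr; apply: (ub_le_sup opnorm_has_ubound).
by exists ((enorm w)^-1 *: w) => //=; rewrite enormZ gtr0_norm ?invr_gt0// mulVf.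
Qed.

(** Each entry of [X] is a coordinate of the image of a basis vector, so a nonpositive operator norm
    would make all entries vanish. *)
Lemma opnorm_gt0 : X != 0 -> 0 < opnorm X.
Proof.
rewrite ltNge; apply: contraNN => X0; apply/eqP/matrixP => i j; rewrite mxE; apply/eqP.
rewrite -normr_le0.
have -> : X i j = (X *m (delta_mx j 0 : 'cV_p)) i 0 by rewrite -colE mxE.
rewrite (le_trans (enorm_coord _ _))// (le_trans (enorm_mulmx _))//.
by rewrite mulr_le0_ge0// enorm_ge0.
Qed.

End OperatorNorm.

(** * Linear forms, and subdifferentials of strongly convex functions *)

Lemma edot_continuous (R : realType) (n : nat) (q : 'cV[R]_n) :
  continuous (edot q).
Proof.
apply: continuous_big => [|i _ x]; first exact: add_continuous.
by apply: (@cvgM _ _ (nbhs x)); [exact: cvg_cst|exact: coord_continuous].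
Qed.

Section StrongConvexity.
Variables (R : realType) (p : nat) (J : 'cV[R]_p -> \bar R) (alpha : R).
Implicit Types (w x z q : 'cV[R]_p).

Hypothesis alpha_gt0 : 0 < alpha.
Hypothesis J_proper : proper_fun J.
Hypothesis J_strong : forall x z a b l, J x = a%:E -> J z = b%:E -> 0 < l < 1 ->
  exists2 c, J (l *: x + (1 - l) *: z) = c%:E &
    c + alpha / 2 * l * (1 - l) * enorm (x - z) ^+ 2 <= l * a + (1 - l) * b.

Lemma subdifferential_fin w q : subdifferential J w q -> exists a, J w = a%:E.
Proof.
case: J_proper => J_noo [x Jx] /(_ x).
case: (J w) (J_noo w) => [a _ _|_|//]; first by exists a.
by case: (J x) Jx.
Qed.

(** The subgradient inequality at [l *: z + (1 - l) *: w], combined with strong convexity and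
    divided by [l], gives [(1 - l) * M <= B]; then [l] is made small. *)
Lemma subdifferential_growth w q z a b :
  subdifferential J w q -> J w = a%:E -> J z = b%:E ->
  a + edot q (z - w) + alpha / 2 * enorm (z - w) ^+ 2 <= b.
Proof.
move=> qw Jw Jz; set M := alpha / 2 * _; set B := b - a - edot q (z - w).
have M_ge0 : 0 <= M by rewrite mulr_ge0 ?sqr_ge0// divr_ge0 ?ltW.
have MB l : 0 < l < 1 -> (1 - l) * M <= B.
  move=> l01; have [c Jc cle] := J_strong Jz Jw l01.
  have := qw (l *: z + (1 - l) *: w).
  have -> : l *: z + (1 - l) *: w - w = l *: (z - w).
    by rewrite scalerBl scale1r scalerBr addrAC addrA subrK addrC.
  rewrite Jc Jw -EFinD lee_fin edotZr => ac.
  case/andP: l01 => l0 _; rewrite -(ler_pM2l l0) /B; move: cle; rewrite /M; lra.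
suff : M <= B by rewrite /B; lra.
rewrite leNgt; apply/negP => BM.
have B_ge : M / 2 <= B by have := MB 2^-1 ltac:(lra); lra.
have M_gt0 : 0 < M by lra.
(* In place of a limit: this [l] turns [(1 - l) * M] into the midpoint of [B] and [M], which exceeds
   [B]. *)
pose l := (M - B) / (2 * M).
have lM : l * M = (M - B) / 2 by rewrite /l; field; rewrite gt_eqF.
have l0 : 0 < l by apply: divr_gt0; lra.
have l1 : l < 1 by rewrite -(ltr_pM2r M_gt0) lM; lra.
have := MB l; rewrite l0 l1 mulrBl lM => /(_ isT); lra.
Qed.

(** Sum of the two growth inequalities obtained by exchanging the points; the two halves of [alpha]
    add up. *)
Lemma subdifferential_monotone w1 w2 q1 q2 :
  subdifferential J w1 q1 -> subdifferential J w2 q2 ->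
  alpha * enorm (w1 - w2) ^+ 2 <= edot (q1 - q2) (w1 - w2).
Proof.
move=> q1w1 q2w2.
have [[a Ja] [b Jb]] := (subdifferential_fin q1w1, subdifferential_fin q2w2).
have := subdifferential_growth q1w1 Ja Jb.
have := subdifferential_growth q2w2 Jb Ja.
rewrite -(opprB w1 w2) enormN edotNr edotDl edotNl; lra.
Qed.

(* The sublevel sets of the tilted function [J - edot q] form a Cauchy filter,
   by strong convexity; lower semicontinuity makes its limit a minimizer. *)
Lemma subdifferential_surjective w0 q0 q :
  lower_semicontinuous J -> subdifferential J w0 q0 ->
  exists m, subdifferential J m q.
Proof.
move=> J_lsc q0w0; have [a0 Ja0] := subdifferential_fin q0w0.
pose V := [set r | exists z, J z = (r + edot q z)%:E].
(* [V] collects the finite values of the tilted function. Growth at [w0] bounds them below by a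
   quadratic in [z - w0], and completing the square gives the constant. *)
have V_lb : lbound V (a0 - edot q w0 - enorm (q0 - q) ^+ 2 / (2 * alpha)).
  move=> r [z Jz]; have := subdifferential_growth q0w0 Ja0 Jz.
  have sq : - (enorm (q0 - q) ^+ 2 / (2 * alpha))
      <= edot (q0 - q) (z - w0) + alpha / 2 * enorm (z - w0) ^+ 2.
    rewrite -subr_ge0.
    suff -> : edot (q0 - q) (z - w0) + alpha / 2 * enorm (z - w0) ^+ 2
        - - (enorm (q0 - q) ^+ 2 / (2 * alpha))
        = enorm (alpha *: (z - w0) + (q0 - q)) ^+ 2 / (2 * alpha).
      by rewrite divr_ge0 ?sqr_ge0// mulr_ge0 ?ltW.
    rewrite !sqr_enorm (edotDl (alpha *: _)) !(edotDr _ (alpha *: _)).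
    rewrite !edotZl !edotZr (edotC (z - w0) (q0 - q)); field; exact: lt0r_neq0.
  move: sq; rewrite (edotDl q0) edotNl !(edotDr q) edotNr; lra.
have V_inf : has_inf V.
  split; last by exists (a0 - edot q w0 - enorm (q0 - q) ^+ 2 / (2 * alpha)).
  by exists (a0 - edot q w0), w0; rewrite subrK.
have V_ge r z : J z = (r + edot q z)%:E -> inf V <= r.
  by move=> Jz; apply: (ge_inf V_inf.2); exists z.
pose S e := [set z | exists2 r, J z = (r + edot q z)%:E & r <= inf V + e].
pose G := filter_from [set e : R | 0 < e] S.
(* The tilted function is at least [inf V] at the midpoint and at most [inf V + e] at both ends, so
   the strong convexity gap [alpha / 8 * enorm (x - z) ^+ 2] is at most [e]. *)
have S_cvx e x z : S e x -> S e z -> enorm (x - z) ^+ 2 <= 8 * e / alpha.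
  move=> [r Jx re] [s Jz se].
  have [|c Jc] := J_strong (l := 2^-1) Jx Jz; first by lra.
  have := V_ge (c - edot q (2^-1 *: x + (1 - 2^-1) *: z)) _.
  move=> /(_ (2^-1 *: x + (1 - 2^-1) *: z)); rewrite subrK => /(_ Jc).
  rewrite edotDr !edotZr => h1 h2.
  by rewrite ler_pdivlMr//; lra.
have G_filter : ProperFilter G.
  apply: filter_from_proper => [|e /= e0].
    apply: filter_from_filter; first by exists 1 => /=.
    move=> d e /= d0 e0; exists (Num.min d e); first by rewrite lt_min d0.
    move=> z [r Jz rle]; split; exists r => //; apply: (le_trans rle);
      by rewrite lerD2l ge_min lexx ?orbT.
  have [r [z Jz] /ltW rle] := inf_adherent e0 V_inf.
  by exists z, r.
have G_cauchy : cauchy G.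
  apply/cauchy_exP => e e0.
  (* At this level the squared diameter is at most [e ^+ 2 / 2], hence below [e ^+ 2]. *)
  have d0 : 0 < alpha * e ^+ 2 / 16 by rewrite divr_gt0// mulr_gt0 ?exprn_gt0.
  have [x Sx] : exists x, S (alpha * e ^+ 2 / 16) x.
    by have [r [x Jx] /ltW rle] := inf_adherent d0 V_inf; exists x, r.
  exists x, (alpha * e ^+ 2 / 16) => //= z /(S_cvx _ _ _ Sx) xz; split=> // i j.
  have {xz} : enorm (x - z) < e.
    rewrite -ltr_sqr ?nnegrE ?enorm_ge0 ?(ltW e0)//; apply: le_lt_trans xz _.
    have -> : 8 * (alpha * e ^+ 2 / 16) / alpha = e ^+ 2 / 2.
      by field; rewrite gt_eqF.
    by have := exprn_gt0 2 e0; lra.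
  apply: le_lt_trans; rewrite (ord1 j) /=.
  by apply: le_trans (enorm_coord _ i); rewrite !mxE.
have /cvg_ex[m Gm] : cvg G by exact: cauchy_cvg.
have Jm_le : (J m <= (inf V + edot q m)%:E)%E.
  rewrite leNgt; apply/negP => m_lt.
  have [s s_gt sJ] : exists2 s, inf V + edot q m < s & (s%:E < J m)%E.
    case: (J m) m_lt => [b|_|//]; last by exists (inf V + edot q m + 1); rewrite ?ltrDl ?ltry.
    by rewrite lte_fin => /midf_lt[h1 h2]; exists ((inf V + edot q m + b) / 2).
  have [U mU UJ] := J_lsc _ _ sJ.
  (* Half of the gap pays for the variation of [edot q] near [m], the other half for the sublevel; a
     point [z] meeting both has [J z] below [s], against lower semicontinuity. *)
  pose d := (s - inf V - edot q m) / 2.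
  have d0 : 0 < d by rewrite /d; lra.
  have mW : nbhs m [set z | edot q z < edot q m + d].
    apply: (@edot_continuous R p q m [set r | r < edot q m + d]).
    by apply: lt_nbhsl; rewrite ltrDl.
  have GS : G (S d) by exists d.
  have [z [[Uz Wz] [r Jz rle]]] := filter_ex (filterI (filterI (Gm _ mU) (Gm _ mW)) GS).
  by have := UJ _ Uz; rewrite Jz lte_fin /=; move: Wz rle; rewrite /d /=; lra.
exists m => z.
have := Jm_le; case: (J m) (proj1 J_proper m) => // b _; rewrite lee_fin => bm.
case Jz : (J z) (proj1 J_proper z) => [c| |]// _; last exact: leey.
have := V_ge (c - edot q z) z; rewrite subrK => /(_ Jz).
by rewrite -EFinD lee_fin edotDr edotNr; lra.
Qed.

End StrongConvexity.

(** * The proximity operator as an inverse of the subdifferential *)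

Section Prox.
Variables (R : realType) (p : nat) (J F : 'cV[R]_p -> \bar R) (alpha : R).
Hypothesis alpha_gt0 : 0 < alpha.
Hypothesis J_decomp : forall w, J w = (F w + (alpha / 2 * enorm w ^+ 2)%:E)%E.

(** The convexity gap of [enorm _ ^+ 2] is exactly [l * (1 - l) * enorm (x - z) ^+ 2], so the
    quadratic part of [J] contributes the modulus [alpha]. *)
Lemma strong_convexityD x z a b l :
  proper_fun F -> econvex F -> J x = a%:E -> J z = b%:E -> 0 < l < 1 ->
  exists2 c, J (l *: x + (1 - l) *: z) = c%:E &
    c + alpha / 2 * l * (1 - l) * enorm (x - z) ^+ 2 <= l * a + (1 - l) * b.
Proof.
move=> [F_noo _] F_convex; rewrite !J_decomp => Jx Jz l01.
case: (F x) Jx (F_convex x z l l01) => [fx| |]//= [<-].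
case: (F z) Jz => [fz| |]//= [<-].
case: (F _) (F_noo (l *: x + (1 - l) *: z)) => [f| |]// _.
rewrite -!EFinM -EFinD lee_fin => f_le.
exists (f + alpha / 2 * enorm (l *: x + (1 - l) *: z) ^+ 2) => //.
rewrite !sqr_enorm !edotE (edotC z x); lra.
Qed.

(** Expanding the square turns the proximal objective into [J - edot q] plus a constant, and
    minimality for this function is the subgradient inequality. *)
Lemma prox_argminE q :
  argmin setT (fun u => F u + (alpha / 2 * enorm (u - alpha^-1 *: q) ^+ 2)%:E)%E
  = [set w | subdifferential J w q].
Proof.
have FJ u : (F u + (alpha / 2 * enorm (u - alpha^-1 *: q) ^+ 2)%:E
    = J u + (enorm q ^+ 2 / (2 * alpha) - edot q u)%:E)%E.
  rewrite J_decomp -addeA -EFinD; congr (_ + _%:E)%E.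
  rewrite !sqr_enorm !edotE (edotC u q); field; exact: lt0r_neq0.
have le_sub w z : (J w + (enorm q ^+ 2 / (2 * alpha) - edot q w)%:E
    <= J z + (enorm q ^+ 2 / (2 * alpha) - edot q z)%:E)%E
    = (J w + (edot q (z - w))%:E <= J z)%E.
  rewrite -[RHS](leeD2rE _ _ (_ : (enorm q ^+ 2 / (2 * alpha) - edot q z)%:E \is a fin_num))//.
  rewrite -addeA -EFinD edotDr edotNr; congr (_ + _%:E <= _)%E; ring.
apply/seteqP; split => w /=.
- by move=> [_ w_min] z; rewrite -le_sub -!FJ w_min.
- by move=> qw; split=> // z _; rewrite !FJ le_sub.
Qed.

(** [prox] is a [get], hence a minimizer only if one exists; the point [w] supplies it. *)
Lemma prox_subdifferential w q :
  subdifferential J w q -> subdifferential J (prox alpha F (alpha^-1 *: q)) q.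
Proof.
move=> qw; suff : argmin setT (fun u => F u +
    (alpha / 2 * enorm (u - alpha^-1 *: q) ^+ 2)%:E)%E (prox alpha F (alpha^-1 *: q)).
  by rewrite prox_argminE.
by apply: getPex; exists w; rewrite prox_argminE.
Qed.

End Prox.

(** * Fenchel duality: dual solutions as subgradients at the primal solution *)

Lemma dual_argminE (R : realType) (n p : nat) (X : 'M[R]_(n, p))
    (J : 'cV[R]_p -> \bar R) w vbar :
  proper_fun J -> subdifferential J w (- (X^T *m vbar)) ->
  argmin setT (dual_objective X J (X *m w)) =
  [set v | subdifferential J w (- (X^T *m v))].
Proof.
move=> J_proper source; have [a Ja] := subdifferential_fin J_proper source.
(* Weak duality, by testing the supremum in the conjugate at [w]. *)
have dual_ge v : ((- a)%:E <= dual_objective X J (X *m w) v)%E.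
  rewrite -leeBlDr// -EFinD; apply: ereal_sup_ubound; exists w => //.
  by rewrite Ja -EFinB edotNl edot_trmx edotC addrC.
(* The equality case of the Fenchel-Young inequality; [vbar] falls under it, so the dual minimum is
   [- a]. *)
have dual_le v : (dual_objective X J (X *m w) v <= (- a)%:E)%E <->
    subdifferential J w (- (X^T *m v)).
  have -> : (dual_objective X J (X *m w) v <= (- a)%:E)%E =
      (fenchel_conjugate J (- (X^T *m v)) <= (edot (- (X^T *m v)) w - a)%:E)%E.
    by rewrite -leeBrDr// -EFinB edotNl edot_trmx edotC [in RHS]addrC.
  split=> [le_a z|sub].
    have := le_trans (ereal_sup_ubound (ex_intro2 _ _ z I erefl)) le_a.
    rewrite Ja; case: (J z) (proj1 J_proper z) => [b| |]// _; last by rewrite leey.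
    by rewrite -EFinB -EFinD !lee_fin edotDr [edot _ (- w)]edotNr; lra.
  apply: ge_ereal_sup => _ [z _ <-]; have := sub z.
  rewrite Ja; case: (J z) => [b| |]//; last by rewrite leNye.
  by rewrite -EFinB -EFinD !lee_fin edotDr [edot _ (- w)]edotNr; lra.
apply/seteqP; split => v /=.
- by move=> [_ v_min]; apply/dual_le; apply: le_trans (v_min vbar I) _; apply/dual_le.
- by move=> /dual_le v_le; split=> // z _; apply: le_trans v_le (dual_ge z).
Qed.

(** * Energy estimate for the noisy dual iteration *)

Section InexactDualAscent.
Variables (R : realType) (n p : nat) (X : 'M[R]_(n, p)) (alpha delta : R).
Variables (w : 'cV[R]_p) (yhat v : 'cV[R]_n).
Variables (wt : nat -> 'cV[R]_p) (vt : nat -> 'cV[R]_n).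
Let L := opnorm X.
Let gamma := alpha * L ^- 2.

Hypothesis X_neq0 : X != 0.
Hypothesis alpha_gt0 : 0 < alpha.
Hypothesis noise : enorm (X *m w - yhat) <= delta.
Hypothesis vt0 : vt 0 = 0.
Hypothesis vtS : forall k, vt k.+1 = vt k + gamma *: (X *m wt k - yhat).
Hypothesis monotone : forall k,
  alpha * enorm (wt k - w) ^+ 2 <= - edot (vt k - v) (X *m (wt k - w)).

Let L_gt0 : 0 < L. Proof. exact: opnorm_gt0. Qed.
Let gamma_gt0 : 0 < gamma.
Proof. by rewrite mulr_gt0// invr_gt0 exprn_gt0. Qed.
Let L_ge0 := ltW L_gt0.
Let alpha_ge0 := ltW alpha_gt0.
Let gamma_ge0 := ltW gamma_gt0.
Let ga_gt0 : 0 < gamma * alpha. Proof. exact: mulr_gt0. Qed.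
Let delta_ge0 : 0 <= delta. Proof. exact: le_trans (enorm_ge0 _) noise. Qed.

(* Firm nonexpansiveness of the gradient step on the dual objective. *)
Lemma dual_step_contraction k :
  enorm (vt k - v + gamma *: (X *m (wt k - w))) ^+ 2
    <= enorm (vt k - v) ^+ 2 - gamma * alpha * enorm (wt k - w) ^+ 2.
Proof.
rewrite [leLHS]sqr_enorm edotDl !(edotDr _ (vt k - v)) !edotZl !edotZr.
rewrite (edotC _ (vt k - v)) -!sqr_enorm.
have := monotone k.
have : enorm (X *m (wt k - w)) ^+ 2 <= L ^+ 2 * enorm (wt k - w) ^+ 2.
  by rewrite -exprMn ler_sqr ?nnegrE ?mulr_ge0 ?enorm_ge0// enorm_mulmx.
rewrite -(ler_pM2l (mulr_gt0 gamma_gt0 gamma_gt0)).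
(* The step size satisfies [gamma * L ^+ 2 = alpha]: the quadratic term consumes only half of the
   decrease [2 * gamma * alpha * N] given by the cross term. *)
have -> (N : R) : gamma * gamma * (L ^+ 2 * N) = gamma * alpha * N.
  by rewrite /gamma; field; rewrite gt_eqF.
move=> h; rewrite -(ler_pM2l gamma_gt0); move: h; lra.
Qed.

Lemma dual_energy k :
  gamma * alpha * (\sum_(0 <= j < k) enorm (wt j - w) ^+ 2)
    + enorm (vt k - v) ^+ 2 <= (enorm v + k%:R * gamma * delta) ^+ 2.
Proof.
elim: k => [|k IHk].
  by rewrite big_nil mulr0 !mul0r addr0 add0r vt0 sub0r enormN.
rewrite big_nat_recr//=.
have := dual_step_contraction k; set T := vt k - v + _ => T_le.
(* Exact step plus noise. Since [enorm T <= B], adding a noise of norm at most [gamma * delta] costs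
   at most [2 * gamma * delta * B + (gamma * delta) ^+ 2], which completes the square on the
   right. *)
have -> : vt k.+1 - v = T + gamma *: (X *m w - yhat).
  rewrite /T mulmxBr vtS.
  move: (X *m wt k) (X *m w) (vt k) gamma => A B c g.
  by apply/matrixP => i j; rewrite !mxE; ring.
set N := enorm (wt k - w) ^+ 2 in T_le *; set S := \sum_(_ <= _ < _) _ in IHk *.
set B := enorm v + k%:R * gamma * delta in IHk.
have B_ge0 : 0 <= B by rewrite addr_ge0 ?enorm_ge0// mulr_ge0// mulr_ge0.
have -> : enorm v + k.+1%:R * gamma * delta = B + gamma * delta.
  by rewrite /B -natr1; ring.
have S_ge0 : 0 <= gamma * alpha * S.
  by rewrite mulr_ge0 ?(ltW ga_gt0)// sumr_ge0// => j _; rewrite sqr_ge0.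
have N_ge0 : 0 <= gamma * alpha * N by rewrite mulr_ge0 ?(ltW ga_gt0)// sqr_ge0.
have TB : enorm T <= B by rewrite -ler_sqr ?nnegrE ?enorm_ge0//; lra.
have : enorm (T + gamma *: (X *m w - yhat)) <= enorm T + gamma * delta.
  apply: le_trans (enormD _ _) _; rewrite lerD2l enormZ gtr0_norm//.
  by rewrite ler_pM2l.
have gd_ge0 : 0 <= gamma * delta by rewrite mulr_ge0.
rewrite -ler_sqr ?nnegrE ?addr_ge0 ?enorm_ge0// => /le_trans.
have := ler_wpM2l gd_ge0 TB => h.
rewrite -lerBrDl; apply; lra.
Qed.

Lemma average_error t :
  enorm (t.+1%:R^-1 *: (\sum_(0 <= k < t.+1) wt k) - w)
    <= Num.sqrt t.+1%:R * delta / L + L * enorm v / alpha / Num.sqrt t.+1%:R.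
Proof.
set T : R := t.+1%:R; have T_gt0 : 0 < T by rewrite ltr0n.
have s_gt0 : 0 < Num.sqrt T by rewrite sqrtr_gt0.
have rhs_ge0 : 0 <= Num.sqrt T * delta / L + L * enorm v / alpha / Num.sqrt T.
  by rewrite addr_ge0 ?mulr_ge0 ?invr_ge0 ?enorm_ge0 ?sqrtr_ge0.
have -> : T^-1 *: (\sum_(0 <= k < t.+1) wt k) - w =
      T^-1 *: \sum_(0 <= k < t.+1) (wt k - w).
  rewrite sumrB scalerBr; congr (_ - _).
  by rewrite sumr_const_nat subn0 -scaler_nat scalerA mulVf ?scale1r ?gt_eqF.
rewrite -ler_sqr ?nnegrE ?enorm_ge0// enormZ exprMn.
have := sqr_enorm_sum (fun k => wt k - w) t.+1.
have : gamma * alpha * (\sum_(0 <= k < t.+1) enorm (wt k - w) ^+ 2)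
    <= (enorm v + T * gamma * delta) ^+ 2.
  by apply: le_trans (dual_energy t.+1); rewrite lerDl sqr_ge0.
rewrite -/T; set S := \sum_(_ <= _ < _) _ ^+ 2; set U := enorm _ ^+ 2 => S_le U_le.
have {S_le U_le} : gamma * alpha * U <= T * (enorm v + T * gamma * delta) ^+ 2.
  apply: le_trans (ler_wpM2l (ltW ga_gt0) U_le) _.
  by rewrite mulrCA ler_pM2l.
rewrite -ler_pdivlMl// => U_le.
rewrite gtr0_norm ?invr_gt0//; apply: le_trans (ler_wpM2l (sqr_ge0 _) U_le) _.
have sT : T = Num.sqrt T ^+ 2 by rewrite sqr_sqrtr// ltW.
rewrite le_eqVlt; apply/orP; left; apply/eqP.
(* Nothing is lost here: with [gamma = alpha / L ^+ 2] the two sides coincide. *)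
rewrite {1 2 3}sT /gamma; field.
by rewrite !gt_eqF.
Qed.

End InexactDualAscent.

(** * Error bounds for the averaged DGD iterates *)

Lemma dgd_u_error (R : realType) (n p : nat) (X : 'M[R]_(n, p))
    (J F : 'cV[R]_p -> \bar R) (alpha delta : R) w yhat v t :
  X != 0 -> 0 < alpha -> proper_fun J -> lower_semicontinuous J ->
  proper_fun F -> econvex F ->
  (forall z, J z = (F z + (alpha / 2 * enorm z ^+ 2)%:E)%E) ->
  enorm (X *m w - yhat) <= delta -> subdifferential J w (- (X^T *m v)) ->
  enorm (dgd_u X F alpha yhat t - w)
    <= Num.sqrt t.+1%:R * delta / opnorm X
       + opnorm X * enorm v / alpha / Num.sqrt t.+1%:R.
Proof.
move=> X_neq0 alpha_gt0 J_proper J_lsc F_proper F_convex J_decomp noise kkt.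
apply: (average_error X_neq0 alpha_gt0 noise (vt := dgd_v X F alpha yhat)) => // k.
have J_strong x z a b l := @strong_convexityD _ _ _ _ _ J_decomp x z a b l F_proper F_convex.
(* Surjectivity guarantees that the proximal problem at this dual iterate has a minimizer. *)
have [m qm] := subdifferential_surjective alpha_gt0 J_proper J_strong
  (- (X^T *m dgd_v X F alpha yhat k)) J_lsc kkt.
have := prox_subdifferential alpha_gt0 J_decomp qm.
rewrite scalerN -scaleNr => qk.
have := subdifferential_monotone alpha_gt0 J_proper J_strong qk kkt.
by rewrite -opprD -mulmxN -mulmxDr edotNl edot_trmx.
Qed.

Theorem theorem4p1 (R : realType) (n p : nat) (X : 'M[R]_(n, p))
    (J F : 'cV[R]_p -> \bar R) (alpha : R)
    (y : 'cV[R]_n) (wdag : 'cV[R]_p) (delta : R) (yhat : 'cV[R]_n)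
    (X_neq0 : X != 0)
    (J_proper : proper_fun J) (J_lsc : lower_semicontinuous J)
    (J_strong : strongly_econvex J)
    (alpha_gt0 : 0 < alpha)
    (F_proper : proper_fun F) (F_lsc : lower_semicontinuous F)
    (F_convex : econvex F)
    (J_decomp : forall w, J w = (F w + (alpha / 2 * enorm w ^+ 2)%:E)%E)
    (wdag_sol : argmin [set w | X *m w = y] J = [set wdag])
    (delta_itv : 0 < delta <= 1)
    (yhat_noise : enorm (y - yhat) <= delta)
    (source : exists vbar : 'cV[R]_n,
        subdifferential J wdag (- (X^T *m vbar))) :
  argmin setT (dual_objective X J y) !=set0 /\
  forall vdag : 'cV[R]_n, argmin setT (dual_objective X J y) vdag ->
    let a := 2 * (opnorm X)^-1 in
    let b := opnorm X * enorm vdag * alpha^-1 in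
    let u := dgd_u X F alpha yhat in
    (forall t : nat, (1 <= t)%N ->
       enorm (u t - wdag)
         <= a * t%:R `^ 2^-1 * delta + b * t%:R `^ (- 2^-1)) /\
    (forall c : R, 0 < c ->
       let tdelta := `|Num.ceil (c * delta^-1)|%N in
       enorm (u tdelta - wdag)
         <= (a * (c `^ 2^-1 + 1) + b * c `^ (- 2^-1)) * delta `^ 2^-1).
Proof.
case: source => vbar source.
have Xw : X *m wdag = y.
  have : [set wdag] wdag by [].
  by rewrite -wdag_sol => -[].
have dualE := dual_argminE J_proper source; rewrite Xw in dualE.
rewrite dualE; split=> [|vdag kkt a b u]; first by exists vbar.
have L_gt0 := opnorm_gt0 X_neq0; case/andP: delta_itv => delta_gt0 delta_le1.
have a_ge0 : 0 <= a by rewrite mulr_ge0// invr_ge0 ltW.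
have b_ge0 : 0 <= b.
  by rewrite /b !mulr_ge0 ?enorm_ge0 ?invr_ge0 ?ltW.
have bound t : (1 <= t)%N -> enorm (u t - wdag)
    <= a * Num.sqrt t%:R * delta + b / Num.sqrt t%:R.
  move=> t_ge1; have noise : enorm (X *m wdag - yhat) <= delta by rewrite Xw.
  apply: le_trans (dgd_u_error t X_neq0 alpha_gt0 J_proper J_lsc F_proper
    F_convex J_decomp noise kkt) _.
  have t_ge1R : 1 <= t%:R :> R by rewrite ler1n.
  have s_gt0 : 0 < Num.sqrt t%:R :> R by rewrite sqrtr_gt0 ltr0n.
  apply: lerD.
    (* The average has [t.+1] terms; passing to [t >= 1] uses [t + 1 <= 4 * t] and produces the
       factor 2 in [a]. *)
    have sT_le : Num.sqrt t.+1%:R <= 2 * Num.sqrt t%:R :> R.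
      rewrite -ler_sqr ?nnegrE ?mulr_ge0 ?sqrtr_ge0// exprMn !sqr_sqrtr ?ler0n//.
      by rewrite -natr1; lra.
    rewrite (_ : a * _ * delta = delta / opnorm X * (2 * Num.sqrt t%:R)); last first.
      by rewrite /a; ring.
    rewrite -mulrA mulrC.
    by rewrite ler_wpM2l// divr_ge0// ltW.
  apply: ler_wpM2l => //; rewrite lef_pV2 ?posrE ?sqrtr_gt0 ?ltr0n//.
  by rewrite ler_wsqrtr// ler_nat.
clearbody a b; split=> [t t_ge1|c c_gt0].
  by rewrite powRN powR12_sqrt ?ler0n// bound.
lazy zeta; set t := `|Num.ceil _|%N.
rewrite powRN !powR12_sqrt ?(ltW c_gt0) ?(ltW delta_gt0)//.
set r := Num.sqrt c; set d := Num.sqrt delta.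
have r_gt0 : 0 < r by rewrite sqrtr_gt0.
have d_gt0 : 0 < d by rewrite sqrtr_gt0.
have rE : c = r ^+ 2 by rewrite sqr_sqrtr// ltW.
have dE : delta = d ^+ 2 by rewrite sqr_sqrtr// ltW.
have d_le1 : d <= 1 by rewrite -sqrtr1 ler_wsqrtr.
have cd_gt0 : 0 < c / delta by rewrite divr_gt0.
have ceil_pos : 0 < Num.ceil (c / delta) by rewrite ceil_gt0.
have tE : t%:R = (Num.ceil (c / delta))%:~R :> R.
  by rewrite natr_absz gtr0_norm.
have t_ge1 : (1 <= t)%N by rewrite absz_gt0 gt_eqF.
(* Here [(r / d) ^+ 2] is [c / delta], so rounding up places [t] within 1 above it. *)
have t_ge : (r / d) ^+ 2 <= t%:R.
  by rewrite tE expr_div_n -rE -dE ceil_ge.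
have t_le : t%:R <= (r / d) ^+ 2 + 1.
  by rewrite tE expr_div_n -rE -dE -lerBlDr -[1]/(1%:~R) -intrB ltW// ceilB1_lt.
have rd_gt0 : 0 < r / d by rewrite divr_gt0.
have s_ge : r / d <= Num.sqrt t%:R.
  by rewrite -[leLHS]gtr0_norm// -sqrtr_sqr ler_wsqrtr.
have s_le : Num.sqrt t%:R <= r / d + 1.
  rewrite -[leRHS]gtr0_norm ?addr_gt0// -sqrtr_sqr ler_wsqrtr//.
  by rewrite sqrrD; lra.
apply: le_trans (bound _ t_ge1) _; rewrite mulrDl -!mulrA; apply: lerD.
  apply: ler_wpM2l => //; apply: (le_trans (ler_wpM2r (ltW delta_gt0) s_le)).
  (* The rounding term [d * d] is at most [d] because [delta <= 1]; this is the [+ 1] next to the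
     square root of [c]. *)
  have -> : (r / d + 1) * delta = r * d + d * d.
    by rewrite dE; field; rewrite gt_eqF.
  by rewrite mulrDl lerD2l ler_wpM2r// ltW.
apply: ler_wpM2l => //; rewrite [leRHS]mulrC -invf_div.
by rewrite lef_pV2 ?posrE ?sqrtr_gt0 ?ltr0n.
Qed.
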